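(* Every signed weak morphism of signed graphs $(f,\eta):\Sigma\to\Sigma'$, where $\Sigma=(G,\sigma)$ and $\Sigma'=(G',\sigma')$, induces linear maps \[ (f,\eta)_*:\mathcal H_p^\sigma(\Sigma)\longrightarrow\mathcal H_p^{\sigma'}(\Sigma') \] for all $p\ge0$, and these maps are compatible with identities and composition. Hence canonical signed GLMY homology is functorial on the category of signed graphs and signed weak morphisms.
   Context: Signed graphs and their weak morphisms. A signed graph is a pair $\Sigma=(G,\sigma)$ with $G$ a finite simple graph and $\sigma:E(G)\to\{+1,-1\}$. A signed weak morphism $(f,\eta):(G,\sigma)\to(G',\sigma')$ consists of a vertex map $f:V(G)\to V(G')$ and a function $\eta:V(G)\to\{+1,-1\}$ such that for every edge $uv\in E(G)$: (i) if $f(u)\ne f(v)$, then $f(u)f(v)\in E(G')$ and $\sigma'(f(u)f(v))=\eta(u)\sigma(uv)\eta(v)$; (ii) if $f(u)=f(v)$, then $\sigma(uv)=\eta(u)\eta(v)$. Composition is $(g,\theta)\circ(f,\eta)=(g\circ f,\zeta)$ with $\zeta(v)=\theta(f(v))\eta(v)$; the identity of $\Sigma$ is $(\mathrm{id},\mathbf1)$ with $\mathbf1\equiv+1$. Signed digraphs. A signed digraph is a pair $(D,\sigma)$ where $D=(V(D),A(D))$ is a finite loopless digraph with at most one arrow from $i$ to $j$ for each ordered pair $(i,j)$, and $\sigma:A(D)\to\{+1,-1\}$. The signed double cover $\widetilde D_\sigma$ is the digraph with vertices $i^\varepsilon=(i,\varepsilon)\in V(D)\times\{+1,-1\}$ and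 arrows $i^\varepsilon\to j^{\varepsilon\sigma(ij)}$ for each arrow $i\to j$ of $D$ and each $\varepsilon$; the deck involution is $\tau(i^\varepsilon)=i^{-\varepsilon}$, acting on paths vertexwise. Signed GLMY homology (over $\mathbb R$). A $p$-path on $V(D)\times\{+1,-1\}$ is a sequence of $p+1$ lifted vertices; it is regular if consecutive lifted vertices are distinct and allowed if consecutive lifted vertices are joined by arrows of $\widetilde D_\sigma$. $\mathcal R_p(\widetilde D_\sigma)$ is the real vector space with basis $e_{\widetilde\gamma}$, $\widetilde\gamma$ a regular $p$-path (no arrow condition), with boundary $e_{v_0\cdots v_p}\mapsto\sum_{q=0}^p(-1)^qe_{v_0\cdots\widehat{v_q}\cdots v_p}$ for $p\ge1$ (nonregular terms are zero), and zero boundary for $p=0$. $R_p^\sigma(D)$ is the quotient of $\mathcal R_p(\widetilde D_\sigma)$ by the span of all $e_{\tau\widetilde\gamma}+e_{\widetilde\gamma}$; $[e_{\widetilde\gamma}]$ is the class of $e_{\widetilde\gamma}$. The boundary induces $\partial^\sigma_{\mathrm{reg},p}:R_p^\sigma(D)\to R_{p-1}^\sigma(D)$ (zero for $p=0$). $\mathcal A_p^\sigma(D)\subseteq R_p^\sigma(D)$ is the span of the classes of allowed paths. Set $\Omega_0^\sigma(D)=\mathcal A_0^\sigma(D)$, $\Omega_p^\sigma(D)=\{z\in\mathcal A_p^\sigma(D):\partial^\sigma_{\mathrm{reg},p}z\in\mathcal A^\sigma_{p-1}(D)\}$ for $p\ge1$, $\Omega_{-1}^\sigma(D)=0$, with boundary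 the restriction of $\partial^\sigma_{\mathrm{reg},p}$. $H_p^\sigma(D)$ is the homology of this complex. Canonical signed GLMY homology. The bidirected completion $\overleftrightarrow\Sigma$ of $\Sigma=(G,\sigma)$ is the signed digraph obtained by replacing every edge $uv$ by the two arrows $u\to v$ and $v\to u$, both with sign $\sigma(uv)$. Define $\mathcal H_p^\sigma(\Sigma):=H_p^\sigma(\overleftrightarrow\Sigma)$. Induced maps. Given $(f,\eta)$, put $\widetilde f(i^\varepsilon)=f(i)^{\eta(i)\varepsilon}$, extended vertexwise to paths on lifted vertices. The linear map $(f,\eta)_\#:R_p^\sigma(\overleftrightarrow\Sigma)\to R_p^{\sigma'}(\overleftrightarrow{\Sigma'})$ sends $[e_{\widetilde\gamma}]$ to $[e_{\widetilde f(\widetilde\gamma)}]$ if $\widetilde f(\widetilde\gamma)$ is regular and to $0$ otherwise. The induced map in the claim is $(f,\eta)_*[z]=[(f,\eta)_\#z]$ for cycles $z\in\Omega_p^\sigma(\overleftrightarrow\Sigma)$. *)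

(* Defs.v *)
From HB Require Import structures.
From mathcomp Require Import all_boot all_order all_algebra.
From mathcomp Require Import boolp reals.

Set Implicit Arguments.
Unset Strict Implicit.
Unset Printing Implicit Defensive.

Import GRing.Theory.
Local Open Scope ring_scope.
Local Open Scope quotient_scope.

Definition vquot (K : fieldType) (V : vectType K) (W : {vspace V}) : Type :=
  Quotient.quot (pred_of_vspace W).

Section QuotientSpace.
Variables (K : fieldType) (V : vectType K) (W : {vspace V}).
Local Notation Q := (vquot W).

HB.instance Definition _ := GRing.Zmodule.on Q.
HB.instance Definition _ := EqQuotient.on Q.

Let pi (x : V) : Q := \pi_Q x.

Lemma vquot_eqE x y : (pi x = pi y) <-> (x - y \in W).
Proof.
have -> : (x - y \in W) = (pi x == pi y).
  exact: (Quotient.idealrBE (pred_of_vspace W)).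
by split=> /eqP.
Qed.

Lemma vquot_reprK (q : Q) : pi (repr q) = q. Proof. exact: reprK. Qed.

Lemma vquot_repr_pi x : repr (pi x) - x \in W.
Proof. by apply/vquot_eqE; rewrite vquot_reprK. Qed.

Lemma vquot_piB : {morph pi : x y / x - y}.
Proof. exact: (@pi_is_zmod_morphism V _ _ (Quotient.quot (pred_of_vspace W))). Qed.

Lemma vquot_piD : {morph pi : x y / x + y}.
Proof.
move=> x y; have p0 : pi 0 = 0 by rewrite -(subrr (0 : V)) vquot_piB subrr.
by rewrite -{1}[y]opprK vquot_piB -[- y]sub0r vquot_piB p0 sub0r opprK.
Qed.

Definition vquot_scale (a : K) (q : Q) : Q := pi (a *: repr q).

Lemma vquot_piZ a x : pi (a *: x) = vquot_scale a (pi x).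
Proof.
apply/vquot_eqE; rewrite -scalerBr -opprB scalerN rpredN rpredZ //.
exact: vquot_repr_pi.
Qed.

Fact vquot_scaleA a b q :
  vquot_scale a (vquot_scale b q) = vquot_scale (a * b) q.
Proof. by rewrite -[q]vquot_reprK -!vquot_piZ scalerA. Qed.
Fact vquot_scale1 : left_id 1 vquot_scale.
Proof. by move=> q; rewrite -[q]vquot_reprK -vquot_piZ scale1r. Qed.
Fact vquot_scaleDr : right_distributive vquot_scale +%R.
Proof.
move=> a q r; rewrite -[q]vquot_reprK -[r]vquot_reprK -vquot_piD -!vquot_piZ.
by rewrite scalerDr vquot_piD.
Qed.
Fact vquot_scaleDl q : {morph vquot_scale^~ q : a b / a + b}.
Proof.
by move=> a b; rewrite -[q]vquot_reprK -!vquot_piZ scalerDl vquot_piD.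
Qed.
HB.instance Definition _ := GRing.Zmodule_isLmodule.Build K Q
  vquot_scaleA vquot_scale1 vquot_scaleDr vquot_scaleDl.

Lemma vquot_pi_linear : linear pi.
Proof. by move=> a x y; rewrite vquot_piD vquot_piZ. Qed.

Fact vquot_vect_iso : Vector.axiom (\dim W^C) Q.
Proof.
pose B := vbasis (W^C)%VS; pose g := daddv_pi W^C W.
have WC0 : (W^C :&: W = 0)%VS by rewrite capvC capv_compl.
have g0 w : w \in W -> g w = 0.
  move=> Ww; apply/eqP; rewrite -memv0 -WC0 memv_cap memv_pi /=.
  have := daddv_pi_add WC0 (w := w).
  rewrite addvC addv_complf memvf => /(_ isT) /(canRL (addrK _)) ->.
  by rewrite rpredB ?memv_pi.
have gE x y : x - y \in W -> g x = g y.
  by move=> /g0 /eqP; rewrite linearB subr_eq0 => /eqP.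
exists (fun q => \row_i coord B i (g (repr q))).
  move=> k q r; apply/rowP=> i; rewrite !mxE -!linearP; congr (coord _ _ _).
  apply: gE; apply/vquot_eqE.
  by rewrite vquot_reprK vquot_pi_linear !vquot_reprK.
exists (fun rv : 'rV_(\dim W^C) => pi (\sum_i rv 0 i *: B`_i)).
  move=> q; rewrite -[RHS]vquot_reprK; apply/vquot_eqE.
  under eq_bigr do rewrite mxE.
  rewrite -coord_vbasis ?memv_pi //.
  have := daddv_pi_add WC0 (w := repr q).
  rewrite addvC addv_complf memvf => /(_ isT) {2}<-.
  by rewrite opprD addrA subrr sub0r rpredN memv_pi.
move=> rv; apply/rowP=> i; rewrite mxE (gE _ _ (vquot_repr_pi _)).
rewrite /g daddv_pi_id ?coord_sum_free ?(basis_free (vbasisP _)) //.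
by apply: rpred_sum => j _; rewrite rpredZ ?vbasis_mem ?memt_nth.
Qed.
HB.instance Definition _ := Lmodule_hasFinDim.Build K Q vquot_vect_iso.

Definition vpi : 'Hom(V, Q) := linfun pi.

Lemma vpiE x : vpi x = \pi_Q x.
Proof.
pose h := HB.pack_for {linear V -> Q} pi
  (GRing.isLinear.Build _ _ _ _ _ vquot_pi_linear).
exact: (lfunE h).
Qed.

Lemma vpi_eq x y : (vpi x = vpi y) <-> (x - y \in W).
Proof. by rewrite !vpiE; apply: vquot_eqE. Qed.

Lemma vpi_repr (q : Q) : vpi (repr q) = q. Proof. by rewrite vpiE reprK. Qed.

End QuotientSpace.

Section QuotientMap.
Variables (K : fieldType) (V V' : vectType K).
Variables (W : {vspace V}) (W' : {vspace V'}) (g : 'Hom(V, V')).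

(* gW does not occur in the body, but without it the map picked by linfun would *)
(* be meaningless: see quot_mapE.                                             *)
Definition quot_map (gW : (g @: W <= W')%VS) : 'Hom(vquot W, vquot W') :=
  linfun (fun q : vquot W => vpi W' (g (repr q))).

Lemma quot_mapE (gW : (g @: W <= W')%VS) x :
  quot_map gW (vpi W x) = vpi W' (g x).
Proof.
have wd u v : vpi W u = vpi W v -> vpi W' (g u) = vpi W' (g v).
  move=> /vpi_eq uv; apply/vpi_eq; rewrite -linearB.
  by apply: subvP gW _ _; apply: memv_img.
have lin : linear (fun q : vquot W => vpi W' (g (repr q))).
  move=> a q r; rewrite -[in RHS]linearZ -[in RHS]linearD.
  rewrite -[in RHS]linearZ -[in RHS]linearD; apply: wd.
  by rewrite linearD linearZ /= !vpi_repr.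
pose h := HB.pack_for {linear vquot W -> vquot W'}
  (fun q : vquot W => vpi W' (g (repr q))) (GRing.isLinear.Build _ _ _ _ _ lin).
rewrite (lfunE h) /=; apply: wd; exact: vpi_repr.
Qed.

End QuotientMap.

Section LinearExtension.
Variables (K : fieldType) (I : finType) (W : vectType K) (g : I -> W).

Definition lin_ext : 'Hom({ffun I -> K^o}, W) :=
  linfun (fun x : {ffun I -> K^o} => \sum_i x i *: g i).

Lemma lin_extE x : lin_ext x = \sum_i x i *: g i.
Proof.
have lin : linear (fun x : {ffun I -> K^o} => \sum_i x i *: g i).
  move=> a u v; rewrite scaler_sumr -big_split; apply: eq_bigr => i _ /=.
  by rewrite !ffunE scalerDl scalerA.
pose h := HB.pack_for {linear {ffun I -> K^o} -> W}
  (fun x : {ffun I -> K^o} => \sum_i x i *: g i)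
  (GRing.isLinear.Build _ _ _ _ _ lin).
by rewrite (lfunE h).
Qed.

End LinearExtension.

(* Signs are booleans under b |-> (-1) ^+ b: true is -1, false is +1, and the *)
(* product of signs is (+). The sign of a pair that is not an arrow (below:   *)
(* an edge) is a dummy value.                                                 *)
Record sdigraph := SDigraph {
  sd_vert :> finType;
  arrow : rel sd_vert;
  arrow_irr : irreflexive arrow;
  asign : sd_vert -> sd_vert -> bool
}.

Section SignedGLMY.
Variables (R : realType) (D : sdigraph).

Definition lvert : finType := (D * bool)%type.

Definition larrow : rel lvert :=
  [rel x y | arrow x.1 y.1 && (y.2 == x.2 (+) asign x.1 y.1)].

Definition deck (x : lvert) : lvert := (x.1, ~~ x.2).

Definition lpath (p : nat) : finType := p.+1.-tuple lvert.

Definition regular p (t : lpath p) : bool := sorted (fun x y => x != y) t.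

Definition allowed p (t : lpath p) : bool := sorted larrow t.

Definition deck_path p (t : lpath p) : lpath p := map_tuple deck t.

Definition rpath (p : nat) : finType := {t : lpath p | regular t}.

Definition chain (p : nat) : vectType R := {ffun rpath p -> R^o}.

(* This is 0 when t is not regular, so that nonregular terms vanish in the     *)
(* boundary and in induced maps.                                              *)
Definition e p (t : lpath p) : chain p := [ffun g : rpath p => (val g == t)%:R].

Definition face p (t : lpath p.+1) (q : 'I_p.+2) : lpath p :=
  [tuple tnth t (lift q i) | i < p.+1].

Definition bd p : 'Hom(chain p.+1, chain p) :=
  lin_ext (fun g : rpath p.+1 =>
    \sum_(q < p.+2) (-1) ^+ q *: e (face (val g) q)).

Definition deck_rel p : {vspace chain p} :=
  <<[seq (e (deck_path (val g)) + e (val g))%R | g : rpath p]>>%VS.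

Lemma lin_ext_e p (W : vectType R) (h : lpath p -> W) (t : lpath p) :
  regular t -> lin_ext (fun g : rpath p => h (val g)) (e t) = h t.
Proof.
move=> rt; rewrite lin_extE (bigD1 (Sub t rt : rpath p)) //= !ffunE eqxx scale1r.
rewrite big1 ?addr0 // => g ng; rewrite ffunE.
by rewrite (negPf (_ : val g != t)) ?scale0r // -[t](SubK (rpath p) rt) val_eqE.
Qed.

Lemma deckK : involutive deck.
Proof. by case=> i b; rewrite /deck /= negbK. Qed.

Lemma deck_regular p (t : lpath p) : regular (deck_path t) = regular t.
Proof.
rewrite /regular /= sorted_map; case: t => [[|x s]] //= _.
by apply: eq_path => u v /=; rewrite (inj_eq (inv_inj deckK)).
Qed.

Lemma e_nonregular p (t : lpath p) : ~~ regular t -> e t = 0.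
Proof.
move=> nt; apply/ffunP=> g; rewrite !ffunE; case: eqP => // gt.
by rewrite -gt (valP g) in nt.
Qed.

Lemma deck_relP p (t : lpath p) : e (deck_path t) + e t \in deck_rel p.
Proof.
have [rt|nt] := boolP (regular t); last first.
  by rewrite !e_nonregular ?deck_regular // addr0 mem0v.
by apply/memv_span/imageP; exists (Sub t rt).
Qed.

Lemma face_deck p (t : lpath p.+1) q :
  face (deck_path t) q = deck_path (face t q).
Proof. by apply: eq_from_tnth => i; rewrite !(tnth_map, tnth_ord_tuple). Qed.

Lemma bd_e p (t : lpath p.+1) : regular t ->
  bd p (e t) = \sum_(q < p.+2) (-1) ^+ q *: e (face t q).
Proof.
exact: (lin_ext_e
  (fun t : lpath p.+1 => \sum_(q < p.+2) (-1) ^+ q *: e (face t q))).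
Qed.

Lemma bd_deck p : (bd p @: deck_rel p.+1 <= deck_rel p)%VS.
Proof.
rewrite limg_span; apply/span_subvP => _ /mapP[_ /mapP[g _ ->] ->].
have rg := valP g.
rewrite linearD /= !bd_e ?deck_regular //.
rewrite -big_split rpred_sum // => q _ /=.
by rewrite -scalerDr rpredZ // face_deck deck_relP.
Qed.

Definition schain (p : nat) : vectType R := vquot (deck_rel p).

Definition cls p (t : lpath p) : schain p := vpi (deck_rel p) (e t).

Definition sbd p : 'Hom(schain p.+1, schain p) := quot_map (bd_deck p).

Definition allowed_chains p : {vspace schain p} :=
  <<[seq cls t | t in @allowed p]>>%VS.

(* The boundary out of degree 0 is zero, so that degree 0 carries no boundary   *)
(* condition in omega and cycles.                                             *)
Definition omega p : {vspace schain p} :=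
  match p with
  | 0 => allowed_chains 0
  | p'.+1 => (allowed_chains p'.+1 :&: sbd p' @^-1: allowed_chains p')%VS
  end.

Definition cycles p : {vspace schain p} :=
  match p with
  | 0 => omega 0
  | p'.+1 => (omega p'.+1 :&: lker (sbd p'))%VS
  end.

Definition boundaries p : {vspace schain p} := (sbd p @: omega p.+1)%VS.

Definition boundaries_in_cycles p : {vspace subvs_of (cycles p)} :=
  (linfun vsval @^-1: boundaries p)%VS.

Definition homology p : vectType R := vquot (boundaries_in_cycles p).

Definition hclass p : 'Hom(subvs_of (cycles p), homology p) :=
  vpi (boundaries_in_cycles p).

End SignedGLMY.

Record sgraph := SGraph {
  sg_vert :> finType;
  edge : rel sg_vert;
  edge_sym : symmetric edge;
  edge_irr : irreflexive edge;
  esign : sg_vert -> sg_vert -> bool;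
  esign_sym : forall u v, edge u v -> esign u v = esign v u
}.

Definition bidir (S : sgraph) : sdigraph :=
  SDigraph (@edge_irr S) (@esign S).

Definition weak_morphism (S S' : sgraph) (f : S -> S') (eta : S -> bool) : Prop :=
  forall u v, edge u v ->
    (f u <> f v ->
       edge (f u) (f v) /\
       esign (f u) (f v) = eta u (+) esign u v (+) eta v) /\
    (f u = f v -> esign u v = eta u (+) eta v).

Record wmor (S S' : sgraph) := WMor {
  wm_map : S -> S';
  wm_sign : S -> bool;
  wmP : weak_morphism wm_map wm_sign
}.

Fact wm_id_proof (S : sgraph) : @weak_morphism S S id (fun=> false).
Proof.
move=> u v uv; split=> [_|euv]; first by rewrite addbF.
by rewrite euv edge_irr in uv.
Qed.

Definition wm_id (S : sgraph) : wmor S S := WMor (@wm_id_proof S).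

Fact wm_comp_proof (S1 S2 S3 : sgraph) (n : wmor S2 S3) (m : wmor S1 S2) :
  weak_morphism (wm_map n \o wm_map m)
    (fun v => wm_sign n (wm_map m v) (+) wm_sign m v).
Proof.
move=> u v uv /=; have [mN mE] := wmP m uv.
have [muv|/eqP muv] := eqVneq (wm_map m u) (wm_map m v).
  by rewrite muv; split=> // _; rewrite (mE muv) addbACA addbb.
have [muv' suv] := mN muv; have [nN nE] := wmP n muv'.
split=> [/nN[e' s']|/nE s'].
  split=> //; rewrite s' suv.
  by rewrite -!addbA [wm_sign m v (+) _]addbC.
move: s'; rewrite suv.
by case: (wm_sign n _); case: (wm_sign n _); case: (wm_sign m u);
   case: (wm_sign m v); case: (esign u v).
Qed.

Definition wm_comp (S1 S2 S3 : sgraph) (n : wmor S2 S3) (m : wmor S1 S2) :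
  wmor S1 S3 := WMor (wm_comp_proof n m).

Lemma wmor_eq (S S' : sgraph) (m n : wmor S S') :
  wm_map m = wm_map n -> wm_sign m = wm_sign n -> m = n.
Proof.
case: m n => [f a fP] [g b gP] /= fg ab; subst g b.
by rewrite (Prop_irrelevance fP gP).
Qed.

Section InducedChainMap.
Variables (R : realType) (S S' : sgraph) (m : wmor S S').

Definition wm_lift (x : lvert (bidir S)) : lvert (bidir S') :=
  (wm_map m x.1, wm_sign m x.1 (+) x.2).

Definition wm_path p (t : lpath (bidir S) p) : lpath (bidir S') p :=
  map_tuple wm_lift t.

Definition wm_push p : 'Hom(chain R (bidir S) p, chain R (bidir S') p) :=
  lin_ext (fun g : rpath (bidir S) p => e R (wm_path (val g))).

Lemma wm_path_deck p (t : lpath (bidir S) p) :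
  wm_path (deck_path t) = deck_path (wm_path t).
Proof.
apply: eq_from_tnth => i; rewrite !tnth_map /wm_lift /deck /=.
by rewrite addbN.
Qed.

Lemma wm_path_regular p (t : lpath (bidir S) p) :
  regular (wm_path t) -> regular t.
Proof.
rewrite /regular /= sorted_map; case: t => [[|x s]] //= _.
by apply: sub_path => u v /=; apply: contraNneq => ->.
Qed.

Lemma wm_push_e p (t : lpath (bidir S) p) : wm_push p (e R t) = e R (wm_path t).
Proof.
have [rt|nt] := boolP (regular t); first exact: (lin_ext_e (fun t : lpath (bidir S) p => e R (wm_path t)) rt).
rewrite !e_nonregular ?linear0 //.
by apply: contra nt; apply: wm_path_regular.
Qed.

Lemma wm_push_deck p :
  (wm_push p @: deck_rel R (bidir S) p <= deck_rel R (bidir S') p)%VS.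
Proof.
rewrite limg_span; apply/span_subvP => _ /mapP[_ /mapP[g _ ->] ->].
by rewrite linearD /= !wm_push_e wm_path_deck deck_relP.
Qed.

Definition wm_sharp p : 'Hom(schain R (bidir S) p, schain R (bidir S') p) :=
  quot_map (wm_push_deck p).

End InducedChainMap.

Record category := Category {
  obj :> Type;
  hom : obj -> obj -> Type;
  idm : forall a, hom a a;
  comp : forall a b c, hom b c -> hom a b -> hom a c;
  comp1m : forall a b (f : hom a b), comp (idm b) f = f;
  compm1 : forall a b (f : hom a b), comp f (idm a) = f;
  compmA : forall a b c d (h : hom c d) (g : hom b c) (f : hom a b),
    comp h (comp g f) = comp (comp h g) f
}.

Definition functorial (C D : category) (Fo : C -> D)
    (Fm : forall a b, hom a b -> hom (Fo a) (Fo b)) : Prop :=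
  (forall a, Fm a a (idm a) = idm (Fo a)) /\
  (forall a b c (g : hom b c) (f : hom a b),
     Fm a c (comp g f) = comp (Fm b c g) (Fm a b f)).

Section Categories.

Fact wm_comp1m S S' (m : wmor S S') : wm_comp (wm_id S') m = m.
Proof. by apply: wmor_eq. Qed.
Fact wm_compm1 S S' (m : wmor S S') : wm_comp m (wm_id S) = m.
Proof. by apply: wmor_eq => //; apply: funext => v; rewrite /= addbF. Qed.
Fact wm_compmA S1 S2 S3 S4 (h : wmor S3 S4) (g : wmor S2 S3) (f : wmor S1 S2) :
  wm_comp h (wm_comp g f) = wm_comp (wm_comp h g) f.
Proof. by apply: wmor_eq => //; apply: funext => v; rewrite /= addbA. Qed.

Definition sgraph_cat : category :=
  Category wm_comp1m wm_compm1 wm_compmA.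

Variable R : realType.

Definition vect_cat : category :=
  @Category (vectType R) (fun U V => 'Hom(U, V)) (fun U => \1%VF)
    (fun U V W g f => (g \o f)%VF)
    (fun U V f => comp_lfun1l f) (fun U V f => comp_lfun1r f)
    (fun U1 U2 U3 U4 h g f => comp_lfunA h g f).

End Categories.

Definition canonical_homology (R : realType) (p : nat) (S : sgraph) : vectType R :=
  homology R (bidir S) p.

(* Main.v *)
(* The lift of a weak morphism sends an arrow of the double cover either to an *)
(* arrow or, when the edge is contracted, to a single lifted vertex: condition *)
(* (ii) makes the two signs agree. So allowed paths go to allowed or           *)
(* nonregular paths. The pushforward commutes with the boundary because the    *)
(* alternating sum of the faces of a nonregular path vanishes.                 *)

Require Import Defs.
From mathcomp Require Import all_boot all_order all_algebra.
From mathcomp Require Import boolp reals.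
From mathcomp Require Import zify.

Set Implicit Arguments.
Unset Strict Implicit.
Unset Printing Implicit Defensive.

Import GRing.Theory.
Local Open Scope ring_scope.

(** The lift of a weak morphism commutes with the deck involution, so it acts on [schain] as
    [wm_sharp]. This action commutes with the boundary ([wm_sharp_sbd]) and preserves allowed chains
    ([wm_sharp_allowed]), hence also [omega], cycles and boundaries, and so passes to homology.
    Identities between such maps are checked on classes of paths, where functoriality says that
    lifts compose vertexwise. *)

Lemma vquot_hom_eq (K : fieldType) (V U : vectType K) (W : {vspace V})
    (F G : 'Hom(vquot W, U)) :
  (forall x, F (vpi W x) = G (vpi W x)) -> F = G.
Proof. by move=> FG; apply/lfunP=> q; rewrite -[q]vpi_repr. Qed.

Section Chains.
Variables (R : realType) (D : sdigraph).

Lemma chain_sum p (x : chain R D p) : x = \sum_g x g *: e R (val g).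
Proof.
apply/ffunP=> h; rewrite sum_ffunE (bigD1 h) //= !ffunE eqxx big1 ?addr0.
  by rewrite -[_ *: _]/(_ * _) mulr1.
move=> g ng; rewrite !ffunE -[_ *: _]/(_ * _).
by rewrite (inj_eq val_inj) eq_sym (negPf ng) mulr0.
Qed.

Lemma chain_hom_eq p (W : vectType R) (F G : 'Hom(chain R D p, W)) :
  (forall t, F (e R t) = G (e R t)) -> F = G.
Proof.
move=> FG; apply/lfunP=> x; rewrite [x]chain_sum !linear_sum.
by apply: eq_bigr => g _; rewrite !linearZ /= FG.
Qed.

Lemma schain_hom_eq p (W : vectType R) (F G : 'Hom(schain R D p, W)) :
  (forall t, F (cls R t) = G (cls R t)) -> F = G.
Proof.
move=> FG; apply: vquot_hom_eq => x; rewrite -!comp_lfunE; congr (fun_of_lfun _ _).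
by apply: chain_hom_eq => t; rewrite !comp_lfunE FG.
Qed.

Lemma regularP p (x0 : lvert D) (t : lpath D p) :
  reflect (forall i, i < p -> nth x0 t i != nth x0 t i.+1)%N (regular t).
Proof.
apply: (iffP (sortedP x0)); rewrite size_tuple => H i ip; exact: H.
Qed.

Lemma nth_face p (x0 : lvert D) (t : lpath D p.+1) (q : 'I_p.+2) j :
  (j < p.+1)%N -> nth x0 (face t q) j = nth x0 t (bump q j).
Proof.
move=> jp; rewrite -[j]/(val (Ordinal jp)) -tnth_nth tnth_mktuple.
by rewrite (tnth_nth x0).
Qed.

(* If the vertices i and i + 1 of t coincide, the faces i and i + 1 cancel and *)
(* every other face still repeats a vertex.                                   *)
Lemma alternating_face_nonregular p (t : lpath D p.+1) : ~~ regular t ->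
  \sum_(q < p.+2) (-1) ^+ q *: e R (face t q) = 0.
Proof.
pose x0 := thead t => nt.
have [i ip ti] : exists2 i, (i < p.+1)%N & nth x0 t i = nth x0 t i.+1.
  apply: contrapT => H; case/negP: nt; apply/(regularP x0) => i ip.
  by apply/eqP => ti; apply: H; exists i.
have i1p : (i < p.+2)%N by lia.
have i2p : (i.+1 < p.+2)%N by lia.
rewrite (bigD1 (Ordinal i1p)) //= (bigD1 (Ordinal i2p)) /=; last first.
  by rewrite -val_eqE /=; lia.
have -> : face t (Ordinal i1p) = face t (Ordinal i2p).
  apply/val_inj/(@eq_from_nth _ x0); rewrite ?size_tuple // => j jp.
  rewrite !nth_face // /bump /=.
  have [->|ji] := eqVneq j i; first by rewrite leqnn ltnn ti.
  by congr nth; lia.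
rewrite addrA exprS mulN1r scaleNr subrr add0r big1 // => q /andP[].
rewrite -!val_eqE /= => qi qi1; rewrite e_nonregular ?scaler0 //.
have qp := ltn_ord q.
apply/negP => /(regularP x0) H.
(* Deleting a vertex before the equal pair moves the pair one place to the left; deleting one after
   it leaves the pair in place. *)
pose j := if (q < i)%N then i.-1 else i.
have [jp bj bj1] : [/\ j < p, bump q j = i & bump q j.+1 = i.+1]%N.
  by rewrite /bump /j; case: ifP => lt_qi; split; lia.
have := H j jp; rewrite !nth_face ?bj ?bj1 ?ti ?eqxx //.
exact: leqW.
Qed.

(** Both sides vanish when [t] is not regular. This case is needed since the image of a regular path
    under a lift may be nonregular. *)
Lemma bd_eE p (t : lpath D p.+1) :
  bd R D p (e R t) = \sum_(q < p.+2) (-1) ^+ q *: e R (face t q).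
Proof.
have [/bd_e //|nt] := boolP (regular t).
by rewrite e_nonregular // linear0 alternating_face_nonregular.
Qed.

Lemma sbd_cls p (t : lpath D p.+1) :
  sbd R D p (cls R t) = \sum_(q < p.+2) (-1) ^+ q *: cls R (face t q).
Proof.
rewrite /sbd quot_mapE bd_eE linear_sum.
by apply: eq_bigr => q _; rewrite linearZ.
Qed.

Lemma cls_allowed p (t : lpath D p) :
  allowed t -> cls R t \in allowed_chains R D p.
Proof. by move=> at_; apply/memv_span/imageP; exists t. Qed.

Lemma cls_nonregular p (t : lpath D p) : ~~ regular t -> cls R t = 0.
Proof. by move=> nt; rewrite /cls e_nonregular ?linear0. Qed.

End Chains.

Section WeakMorphism.
Variables (R : realType) (S S' : sgraph) (m : wmor S S').

Lemma wm_sharp_cls p (t : lpath (bidir S) p) :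
  wm_sharp R m p (cls R t) = cls R (wm_path m t).
Proof. by rewrite /wm_sharp quot_mapE wm_push_e. Qed.

Lemma wm_path_face p (t : lpath (bidir S) p.+1) q :
  wm_path m (face t q) = face (wm_path m t) q.
Proof. by apply: eq_from_tnth => i; rewrite !(tnth_map, tnth_ord_tuple). Qed.

(** On the class of a path, both sides are the alternating sum of the faces of the image path,
    whether or not that image is regular. *)
Lemma wm_sharp_sbd p z :
  sbd R (bidir S') p (wm_sharp R m p.+1 z) = wm_sharp R m p (sbd R (bidir S) p z).
Proof.
rewrite -!comp_lfunE; congr (fun_of_lfun _ _); apply: schain_hom_eq => t.
rewrite !comp_lfunE wm_sharp_cls !sbd_cls linear_sum.
by apply: eq_bigr => q _; rewrite linearZ /= wm_sharp_cls wm_path_face.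
Qed.

Lemma wm_lift_larrow x y : larrow x y ->
  wm_lift m x != wm_lift m y -> larrow (wm_lift m x) (wm_lift m y).
Proof.
case: x y => [u a] [v b] /= /andP[/= uv /eqP ->].
have [mN mE] := wmP m uv; rewrite /wm_lift /larrow /=.
have [muv|/eqP muv] := eqVneq (wm_map m u) (wm_map m v).
  (* On a contracted edge, condition (ii) gives both endpoints the same lift, against the assumption
     that the lifts differ. *)
  rewrite muv (mE muv); case: (wm_sign m u) (wm_sign m v) a => [] [] [];
  by rewrite eqxx.
have [-> ->] := mN muv; move=> _ /=.
by case: (wm_sign m u) (wm_sign m v) a (esign u v) => [] [] [] [].
Qed.

Lemma wm_path_allowed p (t : lpath (bidir S) p) :
  allowed t -> regular (wm_path m t) -> allowed (wm_path m t).
Proof.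
rewrite /allowed /regular /= !sorted_map; case: t => [[|x s]] //= _.
elim: s x => //= y s IH x /andP[xy ys] /andP[nxy nys].
by rewrite /= (wm_lift_larrow xy nxy) IH.
Qed.

Lemma wm_sharp_allowed p z : z \in allowed_chains R (bidir S) p ->
  wm_sharp R m p z \in allowed_chains R (bidir S') p.
Proof.
move=> az; suff: (wm_sharp R m p @: allowed_chains R (bidir S) p <=
  allowed_chains R (bidir S') p)%VS by move/subvP; apply; apply: memv_img.
rewrite limg_span; apply/span_subvP => _ /mapP[_ /imageP[t at_ ->] ->].
rewrite wm_sharp_cls; have [rt|/cls_nonregular->] := boolP (regular (wm_path m t)).
  by apply: cls_allowed; apply: wm_path_allowed.
exact: mem0v.
Qed.

Lemma wm_sharp_omega p z : z \in omega R (bidir S) p ->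
  wm_sharp R m p z \in omega R (bidir S') p.
Proof.
case: p z => [|p] z /=; first exact: wm_sharp_allowed.
rewrite !memv_cap -!memv_preim => /andP[az abz].
by rewrite wm_sharp_allowed // wm_sharp_sbd wm_sharp_allowed.
Qed.

Lemma wm_sharp_cycles p z : z \in cycles R (bidir S) p ->
  wm_sharp R m p z \in cycles R (bidir S') p.
Proof.
case: p z => [|p] z; first exact: wm_sharp_omega.
move=> /memv_capP[/wm_sharp_omega oz]; rewrite memv_ker => /eqP bz.
by apply/memv_capP; rewrite memv_ker wm_sharp_sbd bz linear0.
Qed.

Lemma wm_sharp_boundaries p z : z \in boundaries R (bidir S) p ->
  wm_sharp R m p z \in boundaries R (bidir S') p.
Proof.
move=> /memv_imgP[w ow ->]; rewrite -wm_sharp_sbd.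
by apply: memv_img; apply: wm_sharp_omega.
Qed.

(** [vsproj] only serves to land in the subspace type: it changes nothing here, because [wm_sharp]
    sends cycles to cycles. *)
Definition wm_cycle p :
    'Hom(subvs_of (cycles R (bidir S) p), subvs_of (cycles R (bidir S') p)) :=
  (linfun (vsproj (cycles R (bidir S') p)) \o wm_sharp R m p \o linfun vsval)%VF.

Lemma wm_cycleE p z : vsval (wm_cycle p z) = wm_sharp R m p (vsval z).
Proof.
rewrite !comp_lfunE !lfunE vsprojK //.
by apply: wm_sharp_cycles; apply: subvsP.
Qed.

Fact wm_cycle_boundaries p :
  (wm_cycle p @: boundaries_in_cycles R (bidir S) p <=
   boundaries_in_cycles R (bidir S') p)%VS.
Proof.
apply/subvP => _ /memv_imgP[z bz ->]; move: bz.
rewrite -!memv_preim !(lfunE vsval) [X in _ -> is_true (X \in _)]wm_cycleE.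
exact: wm_sharp_boundaries.
Qed.

Definition wm_homology p :
    'Hom(canonical_homology R p S, canonical_homology R p S') :=
  quot_map (@wm_cycle_boundaries p).

Lemma wm_homologyE p z :
  wm_homology p (hclass R (bidir S) p z) = hclass R (bidir S') p (wm_cycle p z).
Proof. exact: quot_mapE. Qed.

End WeakMorphism.

Lemma wm_sharp_id R S p z : wm_sharp R (wm_id S) p z = z.
Proof.
rewrite -[RHS]id_lfunE; congr (fun_of_lfun _ _); apply: schain_hom_eq => t.
rewrite wm_sharp_cls id_lfunE; congr cls.
by apply: eq_from_tnth => i; rewrite tnth_map; case: (tnth t i).
Qed.

(** The sign of a composite is the product of the signs along the way, so by associativity its lift
    is the composite of the lifts. *)
Lemma wm_sharp_comp R S1 S2 S3 (n : wmor S2 S3) (m : wmor S1 S2) p z :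
  wm_sharp R (wm_comp n m) p z = wm_sharp R n p (wm_sharp R m p z).
Proof.
rewrite -[RHS]comp_lfunE; congr (fun_of_lfun _ _); apply: schain_hom_eq => t.
rewrite comp_lfunE !wm_sharp_cls; congr cls.
by apply: eq_from_tnth => i; rewrite !tnth_map /wm_lift /= addbA.
Qed.

(** The first clause determines [F], since every homology class is [hclass] of a cycle;
    functoriality thus concerns exactly the map induced by [wm_sharp]. *)
Theorem theorem5p8 (R : realType) (p : nat) :
  exists F : forall S S' : sgraph, wmor S S' ->
      'Hom(canonical_homology R p S, canonical_homology R p S'),
    (forall (S S' : sgraph) (m : wmor S S')
        (z : subvs_of (cycles R (bidir S) p)),
      exists2 z' : subvs_of (cycles R (bidir S') p),
        vsval z' = wm_sharp R m p (vsval z) &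
        F S S' m (hclass R (bidir S) p z) = hclass R (bidir S') p z')
    /\ functorial (C := sgraph_cat) (D := vect_cat R)
         (Fo := canonical_homology R p) F.
Proof.
exists (fun S S' m => wm_homology R m p); split.
  by move=> S S' m z; exists (wm_cycle R m p z); rewrite ?wm_cycleE ?wm_homologyE.
(* Both laws are tested on classes of cycles and reduce to the same laws for [wm_sharp] on the
   underlying chains. *)
split=> [S|S1 S2 S3 n m] /=; apply: vquot_hom_eq => z.
  rewrite id_lfunE [LHS]wm_homologyE; congr (hclass _ _ _ _).
  by apply: val_inj; rewrite /= wm_cycleE wm_sharp_id.
rewrite comp_lfunE [LHS]wm_homologyE.
rewrite [X in wm_homology _ _ _ X]wm_homologyE wm_homologyE.
congr (hclass _ _ _ _); apply: val_inj.
by rewrite /= !wm_cycleE wm_sharp_comp.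
Qed.
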